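(* Let $X$ be a topological space and $S$ a subspace of $X$. Then the space $S/{\equiv}$ is homeomorphic to some subspace of $X/{\equiv}$.
   Context: For a topological space $X$, points $x,y\in X$ are topologically indistinguishable, written $x\equiv y$, if every open set containing $x$ contains $y$ and vice versa; this is an equivalence relation. The Kolmogorov quotient $X/{\equiv}$ is the set of equivalence classes with the quotient topology: a set is open in $X/{\equiv}$ if and only if its preimage under the quotient map $X\to X/{\equiv}$ is open in $X$. The space $S/{\equiv}$ is the Kolmogorov quotient of $S$ with its subspace topology, formed using the topological indistinguishability relation of the space $S$. *)

(* Defs.v *)
From HB Require Import structures.
From mathcomp Require Import all_boot generic_quotient.
From mathcomp Require Import all_classical.
From mathcomp Require Import topology.

Set Implicit Arguments.
Unset Strict Implicit.
Unset Printing Implicit Defensive.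

Local Open Scope classical_set_scope.
Local Open Scope quotient_scope.

Section TopologicalIndistinguishability.
Variable T : topologicalType.

Definition top_indist (x y : T) : Prop :=
  (forall U : set T, open U -> U x -> U y) /\
  (forall U : set T, open U -> U y -> U x).

(* Generic quotients are taken by boolean relations. *)
Definition top_indistb (x y : T) : bool := `[< top_indist x y >].

Lemma top_indistb_refl : reflexive top_indistb.
Proof. by move=> x; apply/asboolP; split. Qed.

Lemma top_indistb_sym : symmetric top_indistb.
Proof. by move=> x y; apply/asboolP/asboolP => -[]. Qed.

Lemma top_indistb_trans : transitive top_indistb.
Proof.
move=> y x z /asboolP[xy yx] /asboolP[yz zy]; apply/asboolP.
by split=> U oU Uw; [exact: yz _ oU (xy _ oU Uw)|exact: yx _ oU (zy _ oU Uw)].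
Qed.

Canonical top_indist_equiv :=
  EquivRel top_indistb top_indistb_refl top_indistb_sym top_indistb_trans.

End TopologicalIndistinguishability.

Definition kolmogorov_quotient (T : topologicalType) : topologicalType :=
  quotient_topology {eq_quot @top_indistb T}.

Definition homeomorphic (T U : topologicalType) : Prop :=
  exists (f : T -> U) (g : U -> T),
    [/\ cancel f g, cancel g f, continuous f & continuous g].

(* Main.v *)
Require Import Defs.
From mathcomp Require Import all_boot all_classical topology.
From mathcomp Require Import generic_quotient.

Set Implicit Arguments.
Unset Strict Implicit.
Unset Printing Implicit Defensive.

Local Open Scope classical_set_scope.
Local Open Scope quotient_scope.

(** Everything follows from maps that induce the topology of their source
    ([inducing]): the inclusion of [S] into [X] is one by definition of the
    subspace topology, and so is the projection onto the Kolmogorov quotient,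
    because every open set is a union of indistinguishability classes
    ([kproj_inducing]).  Hence so is their composite [S -> X -> X/~].  An inducing
    map preserves and reflects indistinguishability, so this composite factors
    through [S/~], and the factor [S/~ -> X/~] is again inducing
    ([factor_inducing]).  As [S/~] is a T0 space
    ([kolmogorov_quotient_T0]), the factor is injective, and an injective
    inducing map is a homeomorphism onto its range
    ([inducing_homeomorphic_range]). *)

Definition inducing (T U : topologicalType) (f : T -> U) : Prop :=
  forall V : set T, open V <-> exists2 W : set U, open W & f @^-1` W = V.

Definition kproj (T : topologicalType) : T -> kolmogorov_quotient T :=
  \pi_(kolmogorov_quotient T).

Lemma set_val_inducing (X : topologicalType) (S : set X) :
  inducing (set_val : set_type S -> X).
Proof. by []. Qed.

Lemma inducing_comp (T U Z : topologicalType) (f : T -> U) (g : U -> Z) :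
  inducing f -> inducing g -> inducing (g \o f).
Proof.
move=> fI gI V; split=> [/fI[W /gI[W' oW' <-] <-]|[W oW <-]]; first by exists W'.
by apply/fI; exists (g @^-1` W) => //; apply/gI; exists W.
Qed.

Lemma inducing_continuous (T U : topologicalType) (f : T -> U) :
  inducing f -> continuous f.
Proof. by move=> fI; apply/continuousP => W oW; apply/fI; exists W. Qed.

(** Testing against the open sets of [T] amounts to testing the images against
    the open sets of [U], of which they are the preimages. *)
Lemma inducing_top_indist (T U : topologicalType) (f : T -> U) :
  inducing f -> forall x y, top_indist (f x) (f y) <-> top_indist x y.
Proof.
move=> fI x y; split=> -[xy yx]; split=> W.
- by move=> /fI[W' oW' <-]; exact: xy.
- by move=> /fI[W' oW' <-]; exact: yx.
- by move=> oW; apply: (xy (f @^-1` W)); apply/fI; exists W.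
- by move=> oW; apply: (yx (f @^-1` W)); apply/fI; exists W.
Qed.

Lemma kprojP (T : topologicalType) (x y : T) :
  kproj x = kproj y <-> top_indist x y.
Proof.
split=> [xy|xy].
  by apply/asboolP; apply/(@eqmodP _ (top_indist_equiv T)); exact: xy.
by apply: (elimT (@eqmodP _ (top_indist_equiv T) x y)); apply/asboolP.
Qed.

Lemma kprojK (T : topologicalType) (p : kolmogorov_quotient T) :
  kproj (repr p) = p.
Proof. exact: reprK. Qed.

(** An open set is saturated for indistinguishability, so it is the preimage
    of its own image, which is therefore open. *)
Lemma kproj_inducing (T : topologicalType) : inducing (@kproj T).
Proof.
move=> V; split=> [oV|[W oW <-]]; last exact: oW.
have satV : @kproj T @^-1` (@kproj T @` V) = V.
  apply/seteqP; split=> x; last by exists x.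
  by move=> [y Vy /kprojP[yx _]]; exact: yx.
exists (@kproj T @` V) => //.
by change (open (@kproj T @^-1` (@kproj T @` V))); rewrite satV.
Qed.

(** Since the projection is inducing, points indistinguishable in the quotient
    have indistinguishable representatives. *)
Lemma kolmogorov_quotient_T0 (T : topologicalType)
    (p q : kolmogorov_quotient T) : top_indist p q -> p = q.
Proof.
rewrite -(kprojK p) -(kprojK q) => /(inducing_top_indist (@kproj_inducing T)).
by move/kprojP.
Qed.

(** The projection is surjective, so a subset of the quotient is determined by
    its preimage: an equality between preimages along [f \o @kproj T] descends
    to one between preimages along [f]. *)
Lemma factor_inducing (T U : topologicalType)
    (f : kolmogorov_quotient T -> U) :
  inducing (f \o @kproj T) -> inducing f.
Proof.
move=> fI V; split=> [oV|[W oW <-]]; last by apply/fI; exists W.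
have /fI[W oW WV] : open (@kproj T @^-1` V) by exact: oV.
exists W => //; apply/seteqP; split=> p.
  by rewrite -(kprojK p) => Wp; have : (@kproj T @^-1` V) (repr p) by rewrite -WV.
by rewrite -{1}(kprojK p) -[V _]/((@kproj T @^-1` V) (repr p)) -WV /= kprojK.
Qed.

Lemma inducing_homeomorphic_range (T U : topologicalType) (f : T -> U) :
  inducing f -> injective f -> homeomorphic T (set_type (range f)).
Proof.
move=> fI f_inj.
have fr x : f x \in range f by rewrite inE; exists x.
pose F x : set_type (range f) := SigSub (fr x).
have /choice[G GE] (a : set_type (range f)) : exists x, f x = val a.
  by have /set_mem[x _ <-] := valP a; exists x.
exists F, G; split.
- by move=> x; apply: f_inj; rewrite GE.
- by move=> a; apply/val_inj; rewrite /= GE.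
- apply/continuousP => _ [W oW <-].
  by have /continuousP := inducing_continuous fI; exact.
- apply/continuousP => _ /fI[W oW <-]; exists W => //.
  by apply/funext => a /=; rewrite GE.
Qed.

(* A set A of a topological space, seen as the type [set_type A], carries the
   subspace topology (the initial topology of the inclusion). *)
Theorem theorem3p24 (X : topologicalType) (S : set X) :
  exists A : set (kolmogorov_quotient X),
    homeomorphic (kolmogorov_quotient (set_type S)) (set_type A).
Proof.
pose h : set_type S -> kolmogorov_quotient X := @kproj X \o set_val.
have hI : inducing h := inducing_comp (@set_val_inducing X S) (@kproj_inducing X).
pose f (p : kolmogorov_quotient (set_type S)) := h (repr p).
have fE : f \o @kproj (set_type S) = h.
  (* [repr] picks a point of [S] indistinguishable from [s], and [h] sends the
     two to indistinguishable points of a T0 space. *)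
  apply/funext => s; apply: kolmogorov_quotient_T0.
  by apply/(inducing_top_indist hI)/kprojP; exact: kprojK.
have fI : inducing f by apply: factor_inducing; rewrite fE.
exists (range f); apply: inducing_homeomorphic_range => // p q fpq.
(* An inducing map can only identify indistinguishable points. *)
apply/kolmogorov_quotient_T0/(inducing_top_indist fI).
by rewrite fpq; split.
Qed.
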